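(* Let $E$ be a finite-dimensional vector space over a field and let $\mathcal{I}\subseteq\mathcal{L}(E)$ satisfy the independence axioms (I1)–(I4). Let $\mathcal{D}:=\mathcal{L}(E)\setminus\mathcal{I}$. Then $\mathcal{D}$ satisfies: (D1) $\{0\}\notin\mathcal{D}$; (D2) if $D_1\in\mathcal{D}$ and $D_1\subseteq D_2$ then $D_2\in\mathcal{D}$; (D3) for all $D_1,D_2\in\mathcal{D}$ with $D_1\cap D_2\notin\mathcal{D}$, every subspace of codimension $1$ in $D_1+D_2$ belongs to $\mathcal{D}$.
   Context: $\mathcal{L}(E)$ is the lattice of subspaces of $E$. Independence axioms: (I1) $\mathcal{I}\ne\emptyset$; (I2) if $J\in\mathcal{I}$ and $I\subseteq J$ then $I\in\mathcal{I}$; (I3) for $I,J\in\mathcal{I}$ with $\dim I<\dim J$ there is a $1$-dimensional $x\subseteq J$, $x\not\subseteq I$, with $I+x\in\mathcal{I}$; (I4) for all subspaces $A,B$ and all inclusion-maximal members $I$ of $\mathcal{I}$ contained in $A$ and $J$ of $\mathcal{I}$ contained in $B$, there is an inclusion-maximal member $K$ of $\mathcal{I}$ contained in $A+B$ with $K\subseteq I+J$. *)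

(* Defs.v *)
From mathcomp Require Import all_boot all_order all_algebra.
From mathcomp Require Import classical_sets.

Set Implicit Arguments.
Unset Strict Implicit.
Unset Printing Implicit Defensive.

Local Open Scope classical_set_scope.

Section QMatroidAxioms.
Variables (F : fieldType) (E : vectType F).
Implicit Types (A B X Y : {vspace E}) (I D : set {vspace E}).

(* The maximality is relative to the members of I contained in A, not to all
   members of I. *)
Definition maximal_in I A X : Prop :=
  [/\ I X, (X <= A)%VS
    & forall Y, I Y -> (Y <= A)%VS -> (X <= Y)%VS -> Y = X].

Record independence_axioms I : Prop := IndependenceAxioms {
  indep_nonempty : I !=set0;
  indep_sub : forall X Y, I Y -> (X <= Y)%VS -> I X;
  indep_augment : forall X Y, I X -> I Y -> \dim X < \dim Y ->
    exists x : {vspace E},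
      [/\ \dim x = 1, (x <= Y)%VS, ~~ (x <= X)%VS & I (X + x)%VS];
  indep_maximal_add : forall A B X Y,
    maximal_in I A X -> maximal_in I B Y ->
    exists2 Z, maximal_in I (A + B)%VS Z & (Z <= X + Y)%VS
}.

Record dependence_axioms D : Prop := DependenceAxioms {
  dep_zero : ~ D 0%VS;
  dep_sup : forall X Y, D X -> (X <= Y)%VS -> D Y;
  dep_hyperplane : forall X Y, D X -> D Y -> ~ D (X :&: Y)%VS ->
    forall H : {vspace E},
      (H <= X + Y)%VS -> \dim H + 1 = \dim (X + Y) -> D H
}.

End QMatroidAxioms.

(* Main.v *)
Require Import Defs.
From mathcomp Require Import all_boot all_order all_algebra.
From mathcomp Require Import classical_sets.
From mathcomp Require Import boolp zify.

(** For (D3), suppose [H] is independent.  Extend the independent space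
    [D1 :&: D2] to maximal independent [X] in [D1] and [Y] in [D2]; both
    inclusions are strict and [D1 :&: D2 <= X :&: Y], so [X + Y] has
    codimension at least 2 in [D1 + D2].
    By (I4) some maximal independent [Z] in [D1 + D2] lies in [X + Y], so
    [\dim Z < \dim H], and (I3) enlarges [Z], contradicting its maximality. *)

Local Open Scope classical_set_scope.

(** Induction on the codimension of [K] in [A]: if [K] is not maximal, some larger [Y] in [I] within
    [A] has greater dimension. *)
Lemma maximal_in_extend {F : fieldType} {E : vectType F}
    {I : set {vspace E}} {A K : {vspace E}} :
  I K -> (K <= A)%VS -> exists2 X, maximal_in I A X & (K <= X)%VS.
Proof.
have [n] := ubnP (\dim A - \dim K).
elim: n K => // n IHn K ltn IK sKA.
have [maxK|] := pselect (maximal_in I A K); first by exists K.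
move=> nmaxK; have [Y [IY sYA sKY neqYK]] :
    exists Y, [/\ I Y, (Y <= A)%VS, (K <= Y)%VS & Y <> K].
  apply: contrapT => noY; apply: nmaxK; split=> // Y IY sYA sKY.
  by apply: contrapT => neqYK; apply: noY; exists Y.
have ltKY : \dim K < \dim Y.
  rewrite ltn_neqAle dimvS // andbT; apply/negP => eqd.
  by apply: neqYK; apply/eqP; rewrite eq_sym eqEdim sKY (eqP eqd) /=.
have leYA := dimvS sYA.
have [||//|X maxX sYX] := IHn Y; [lia|by []|].
by exists X => //; apply: subv_trans sYX.
Qed.

Lemma dim_maximal_in_lt {F : fieldType} {E : vectType F}
    {I : set {vspace E}} {A X : {vspace E}} :
  ~ I A -> maximal_in I A X -> \dim X < \dim A.
Proof.
move=> nIA [IX sXA _]; rewrite ltn_neqAle dimvS // andbT; apply/negP => eqd.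
by apply: nIA; suff /eqP <- : X == A by []; rewrite eqEdim sXA (eqP eqd) /=.
Qed.

(** Otherwise (I3) adds to [Z] a line [x] taken from [H], so [Z + x] stays inside [A]. *)
Lemma dim_le_maximal_in {F : fieldType} {E : vectType F}
    {I : set {vspace E}} {A H Z : {vspace E}} :
  independence_axioms I -> I H -> (H <= A)%VS -> maximal_in I A Z ->
  \dim H <= \dim Z.
Proof.
move=> hI IH sHA [IZ sZA maxZ]; rewrite leqNgt; apply/negP => ltZH.
have [x [_ sxH /negP nsxZ IZx]] := indep_augment hI IZ IH ltZH.
apply: nsxZ; rewrite -(maxZ _ IZx) ?addvSr ?addvSl //.
by rewrite subv_add sZA (subv_trans sxH).
Qed.

Theorem theorem67 (F : fieldType) (E : vectType F) (I : set {vspace E})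
    (hI : independence_axioms I) :
  dependence_axioms (~` I).
Proof.
split.
- by have [X IX] := indep_nonempty hI; apply; apply: (indep_sub hI IX (sub0v X)).
- by move=> X Y nIX sXY IY; apply: nIX; apply: (indep_sub hI IY sXY).
move=> D1 D2 nI1 nI2 /contrapT IK H sH dimH IH.
have [X maxX sKX] := maximal_in_extend IK (capvSl D1 D2).
have [Y maxY sKY] := maximal_in_extend IK (capvSr D1 D2).
have [Z maxZ sZ] := indep_maximal_add hI maxX maxY.
have leHZ := dim_le_maximal_in hI IH sH maxZ.
have ltX := dim_maximal_in_lt nI1 maxX.
have ltY := dim_maximal_in_lt nI2 maxY.
have leZ := dimvS sZ.
have leK : \dim (D1 :&: D2) <= \dim (X :&: Y) by rewrite dimvS // subv_cap sKX.
(* By the two dimension formulas, [\dim (X + Y)] is at most [(\dim D1 - 1) + (\dim D2 - 1) - \dim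
   (D1 :&: D2)], which is [\dim H - 1]. *)
have := dimv_sum_cap X Y; have := dimv_sum_cap D1 D2.
lia.
Qed.
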